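(* Let $q$ be an odd prime power. The sets $\mathcal{S}_l\cup \mathcal{S}_g$ and $\mathcal{NS}_l\cup \mathcal{NS}_g$ for $q\equiv 1 \pmod 4$, and the sets $\mathcal{S}_l\cup \mathcal{NS}_g$ and $\mathcal{S}_g\cup \mathcal{NS}_l$ for $q\equiv 3\pmod 4$, of planes of the Klein quadric $\mathcal{K}=\mathcal{Q}^+(5,q)$ (defined in the context) do not contain a point-pencil of $\mathcal{K}$. In particular, they are not the union of point-pencils whose vertices are pairwise non-collinear points of $\mathcal{K}$.
   Context: Points, lines and planes of a projective space are the vector subspaces of dimension $1,2,3$. Let $\kappa$ be the Klein correspondence, the bijection (via Plücker coordinates) from the lines of $\mathrm{PG}(3,q)$ to the points of the Klein quadric $\mathcal{K}=\mathcal{Q}^+(5,q)$, a hyperbolic quadric in $\mathrm{PG}(5,q)$. The generators of $\mathcal{K}$ (maximal totally singular subspaces) are planes, of two kinds: Latin planes, whose points are the $\kappa$-images of the lines through a fixed point of $\mathrm{PG}(3,q)$, and Greek planes, whose points are the $\kappa$-images of the lines in a fixed plane of $\mathrm{PG}(3,q)$. Let $Q\cong\mathcal{Q}^+(3,q)$ be the hyperbolic quadric of $\mathrm{PG}(3,q)$ with equation $X_0X_1+X_2X_3=0$, $q$ odd, and let $\perp$ be the polarity of $\mathrm{PG}(3,q)$ associated with $Q$. A point $P(x_0,x_1,x_2,x_3)$ is a square point if $x_0x_1+x_2x_3$ is a non-zero square in $\mathbb{F}_q$, and a non-square point if $x_0x_1+x_2x_3$ is a non-square in $\mathbb{F}_q$.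 For a point $P$ of $\mathrm{PG}(3,q)$ let $\pi^P_l$ be the Latin plane that is the image under $\kappa$ of the set of lines through $P$, and let $\pi^P_g$ be the Greek plane that is the image under $\kappa$ of the set of lines in the plane $P^\perp$. Put $\mathcal{S}_l=\{\pi^P_l : P \text{ a square point}\}$, $\mathcal{NS}_l=\{\pi^P_l : P \text{ a non-square point}\}$, $\mathcal{S}_g=\{\pi^P_g : P \text{ a square point}\}$, $\mathcal{NS}_g=\{\pi^P_g : P \text{ a non-square point}\}$. A point-pencil of $\mathcal{K}$ with vertex a point $P$ of $\mathcal{K}$ is the set of all planes of $\mathcal{K}$ containing $P$. Two points of $\mathcal{K}$ are collinear if the line joining them is contained in $\mathcal{K}$. *)

(* Defs.v *)
From HB Require Import structures.
From mathcomp Require Import all_boot all_order all_algebra.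
From mathcomp Require Import ring.
From mathcomp Require Import boolp classical_sets.

Set Implicit Arguments.
Unset Strict Implicit.
Unset Printing Implicit Defensive.

Import GRing.Theory.

Local Open Scope ring_scope.
Local Open Scope classical_set_scope.

Section ProjectiveSpace.
Variables (F : fieldType) (V : vectType F).
Implicit Types U P l : {vspace V}.

Definition is_point U : Prop := \dim U = 1%N.
Definition is_line U : Prop := \dim U = 2%N.
Definition is_plane U : Prop := \dim U = 3%N.

Definition points_of U : set {vspace V} :=
  [set P | is_point P /\ (P <= U)%VS].

Definition lines_through P : set {vspace V} :=
  [set l | is_line l /\ (P <= l)%VS].

Definition lines_in U : set {vspace V} :=
  [set l | is_line l /\ (l <= U)%VS].

Definition totally_singular (Q : V -> F) U : Prop :=
  forall v, v \in U -> Q v = 0.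

End ProjectiveSpace.

Section HyperbolicQuadric.
Variable F : fieldType.
Implicit Types (x y : 'rV[F]_4) (P : {vspace 'rV[F]_4}).

Definition hypQ x : F := x 0 0 * x 0 1 + x 0 2 * x 0 3.

Definition hypB x y : F := hypQ (x + y) - hypQ x - hypQ y.

Fact hypB_zmod_morphisml y : zmod_morphism (hypB^~ y).
Proof. by move=> u v; rewrite /hypB /hypQ !mxE; ring. Qed.

Fact hypB_zmod_morphismr x : zmod_morphism (hypB x).
Proof. by move=> u v; rewrite /hypB /hypQ !mxE; ring. Qed.

Fact hypB_scalablel y : scalable_for *%R (hypB^~ y).
Proof. by move=> a u; rewrite /hypB /hypQ !mxE; ring. Qed.

Fact hypB_scalabler x : scalable_for (idfun \; *%R) (hypB x).
Proof. by move=> a u; rewrite /hypB /hypQ !mxE /=; ring. Qed.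

HB.instance Definition _ := isBilinear.Build F 'rV[F]_4 'rV[F]_4 F
  ( *%R ) (idfun \; *%R) hypB
  hypB_zmod_morphisml hypB_zmod_morphismr hypB_scalablel hypB_scalabler.

Fact hypB_sym x y : hypB x y = (-1) ^+ false * idfun (hypB y x).
Proof. by rewrite /hypB /hypQ !mxE /=; ring. Qed.

HB.instance Definition _ := isHermitianSesquilinear.Build F 'rV[F]_4
  false idfun hypB hypB_sym.

Definition hyp_perp (U : {vspace 'rV[F]_4}) : {vspace 'rV[F]_4} :=
  orthov (hypB : {symmetric 'rV[F]_4}) U.

(* Rescaling [x] multiplies [hypQ x] by a non-zero square, so the choice of
   the representative [x] of the point is immaterial. *)
Definition square_point P : Prop :=
  exists x, [/\ x != 0, P = <[x]>%VS & exists2 a : F, a != 0 & hypQ x = a ^+ 2].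

Definition non_square_point P : Prop :=
  exists x, [/\ x != 0, P = <[x]>%VS & ~ exists a : F, hypQ x = a ^+ 2].

End HyperbolicQuadric.

Section KleinCorrespondence.
Variable F : fieldType.
Implicit Types (x y : 'rV[F]_4) (z : 'rV[F]_6).
Implicit Types (P l : {vspace 'rV[F]_4}) (pi R : {vspace 'rV[F]_6}).

(* The Pluecker coordinates (p01, p02, p03, p12, p13, p23), where
   pij = xi yj - xj yi. *)
Definition plucker x y : 'rV[F]_6 :=
  let p (i j : 'I_4) := x 0 i * y 0 j - x 0 j * y 0 i in
  \row_(k < 6) [:: p 0 1; p 0 2; p 0 3; p 1 2; p 1 3; p 2 3]`_k.

(* The Pluecker relation p01 p23 - p02 p13 + p03 p12 = 0. *)
Definition kleinQ z : F := z 0 0 * z 0 5 - z 0 1 * z 0 4 + z 0 2 * z 0 3.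

(* Another basis of [l] multiplies the Pluecker vector by the determinant of
   the change of basis, so the choice of [vbasis l] is immaterial. *)
Definition klein l : {vspace 'rV[F]_6} :=
  <[plucker (vbasis l)`_0 (vbasis l)`_1]>%VS.

Definition klein_point R : Prop := is_point R /\ totally_singular kleinQ R.

Definition klein_plane pi : Prop := is_plane pi /\ totally_singular kleinQ pi.

Definition latin_plane P pi : Prop :=
  points_of pi = klein @` lines_through P.

Definition greek_plane P pi : Prop :=
  points_of pi = klein @` lines_in (hyp_perp P).

Definition S_l : set {vspace 'rV[F]_6} :=
  [set pi | exists2 P, square_point P & latin_plane P pi].
Definition NS_l : set {vspace 'rV[F]_6} :=
  [set pi | exists2 P, non_square_point P & latin_plane P pi].
Definition S_g : set {vspace 'rV[F]_6} :=
  [set pi | exists2 P, square_point P & greek_plane P pi].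
Definition NS_g : set {vspace 'rV[F]_6} :=
  [set pi | exists2 P, non_square_point P & greek_plane P pi].

Definition point_pencil R : set {vspace 'rV[F]_6} :=
  [set pi | klein_plane pi /\ (R <= pi)%VS].

Definition klein_collinear (R1 R2 : {vspace 'rV[F]_6}) : Prop :=
  totally_singular kleinQ (R1 + R2)%VS.

Definition contains_point_pencil (S : set {vspace 'rV[F]_6}) : Prop :=
  exists2 R, klein_point R & point_pencil R `<=` S.

Definition union_of_noncollinear_pencils (S : set {vspace 'rV[F]_6}) : Prop :=
  exists V : set {vspace 'rV[F]_6},
    [/\ V `<=` klein_point,
        forall R1 R2, V R1 -> V R2 -> R1 <> R2 -> ~ klein_collinear R1 R2
      & S = \bigcup_(R in V) point_pencil R].

End KleinCorrespondence.

Arguments S_l : clear implicits.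
Arguments NS_l : clear implicits.
Arguments S_g : clear implicits.
Arguments NS_g : clear implicits.

(* Main.v *)
(* The planes through a point [kappa(l)] of the Klein quadric include the Latin
   plane of every point of [l]. As a Latin plane is never a Greek one and
   determines its vertex, a pencil inside one of the four sets would force all
   points of [l] to be square, or all of them to be non-square. But a quadratic
   form on a 2-dimensional space over a field of odd order either represents
   every non-zero scalar or has a non-trivial zero, so neither can happen. *)

Require Import Defs.
From HB Require Import structures.
From mathcomp Require Import all_boot all_algebra.
From mathcomp Require Import classical_sets.
From mathcomp Require Import finfield ring.

Set Implicit Arguments.
Unset Strict Implicit.
Unset Printing Implicit Defensive.

Import GRing.Theory.

Local Open Scope ring_scope.
Local Open Scope classical_set_scope.

(** Case analysis that leaves the index as a numeral, so that entries such as [z 0 3] match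
    syntactically for [ring]. *)
Lemma ord4_ind (P : 'I_4 -> Prop) : P 0 -> P 1 -> P 2 -> P 3 -> forall i, P i.
Proof.
move=> P0 P1 P2 P3 [[|[|[|[|//]]]] ltk].
- by rewrite (_ : Ordinal _ = 0) //; apply: val_inj.
- by rewrite (_ : Ordinal _ = 1) //; apply: val_inj.
- by rewrite (_ : Ordinal _ = 2) //; apply: val_inj.
- by rewrite (_ : Ordinal _ = 3) //; apply: val_inj.
Qed.

Lemma ord6_ind (P : 'I_6 -> Prop) :
  P 0 -> P 1 -> P 2 -> P 3 -> P 4 -> P 5 -> forall i, P i.
Proof.
move=> P0 P1 P2 P3 P4 P5 [[|[|[|[|[|[|//]]]]]] ltk].
- by rewrite (_ : Ordinal _ = 0) //; apply: val_inj.
- by rewrite (_ : Ordinal _ = 1) //; apply: val_inj.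
- by rewrite (_ : Ordinal _ = 2) //; apply: val_inj.
- by rewrite (_ : Ordinal _ = 3) //; apply: val_inj.
- by rewrite (_ : Ordinal _ = 4) //; apply: val_inj.
- by rewrite (_ : Ordinal _ = 5) //; apply: val_inj.
Qed.

(** * Points and lines as spans of vectors *)

Section Spans.
Variables (F : fieldType) (V : vectType F).
Implicit Types (U l : {vspace V}) (x y : V).

Lemma vlineZ (c : F) x : c != 0 -> <[c *: x]>%VS = <[x]>%VS.
Proof.
move=> c0; apply/eqP; rewrite eqEsubv -!memvE memvZ ?memv_line //=.
by apply/vlineP; exists c^-1; rewrite scalerA mulVf // scale1r.
Qed.

Lemma dim_addv_vline U y : y \notin U -> \dim (U + <[y]>) = (\dim U).+1.
Proof.
move=> yU; rewrite dimv_disjoint_sum ?dim_vline; last first.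
  apply/eqP; rewrite -subv0; apply/subvP => w /memv_capP[wU /vlineP[k wE]].
  move: wU; rewrite wE memv0; have [->|k0] := eqVneq k 0; first by rewrite scale0r.
  by rewrite rpredZeq (negPf k0) (negPf yU).
by case: eqP yU => [->|_ _]; rewrite ?mem0v // addn1.
Qed.

Lemma memv_joinP x y w :
  reflect (exists a b, w = a *: x + b *: y) (w \in <[x]> + <[y]>)%VS.
Proof.
apply: (iffP memv_addP) => [[_ /vlineP[a ->] [_ /vlineP[b ->] ->]]|[a [b ->]]].
  by exists a, b.
exists (a *: x); first by rewrite memvZ ?memv_line.
by exists (b *: y); rewrite ?memvZ ?memv_line.
Qed.

Lemma is_pointP U : is_point U <-> exists2 x, x != 0 & U = <[x]>%VS.
Proof.
split=> [dimU|[x x0 ->]]; last by rewrite /is_point dim_vline x0.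
have x0 : vpick U != 0 by rewrite vpick0 -dimv_eq0 dimU.
exists (vpick U) => //; apply/eqP; rewrite eq_sym eqEdim -memvE memv_pick /=.
by rewrite dim_vline x0 dimU.
Qed.

Lemma is_line_join x y : x != 0 -> y \notin <[x]>%VS -> is_line (<[x]> + <[y]>)%VS.
Proof. by move=> x0 yx; rewrite /is_line dim_addv_vline // dim_vline x0. Qed.

Lemma line_joinP l x : is_line l -> x != 0 -> x \in l ->
  exists2 y, y \notin <[x]>%VS & l = (<[x]> + <[y]>)%VS.
Proof.
move=> dim_l x0 xl.
have /subvPn[y yl yx] : ~~ (l <= <[x]>)%VS.
  by apply/negP => /dimvS; rewrite dim_l dim_vline x0.
exists y => //; apply/eqP; rewrite eq_sym eqEdim subv_add -!memvE xl yl /=.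
by rewrite (is_line_join x0 yx) dim_l.
Qed.

Lemma exists_notin U : (\dim U < dim V)%N -> exists y, y \notin U.
Proof.
move=> ltU; have /subvPn[y _ yU] : ~~ (fullv <= U)%VS.
  by apply/negP => /dimvS; rewrite dimvf leqNgt ltU.
by exists y.
Qed.

End Spans.

(** * Plücker coordinates and the bijectivity of the Klein correspondence *)

Section Klein.
Variable F : fieldType.
Implicit Types (x y : 'rV[F]_4) (z : 'rV[F]_6).
Implicit Types (P l : {vspace 'rV[F]_4}) (pi R : {vspace 'rV[F]_6}).

(* The antisymmetric matrix with the Pluecker coordinates [z] as entries; if
   [z] comes from a line, the rows of the matrix span that line. *)
Definition plmx z : 'M[F]_4 :=
  \matrix_(i, j) nth 0 (nth [::] [::
    [:: 0; z 0 0; z 0 1; z 0 2];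
    [:: - z 0 0; 0; z 0 3; z 0 4];
    [:: - z 0 1; - z 0 3; 0; z 0 5];
    [:: - z 0 2; - z 0 4; - z 0 5; 0]] i) j.

Lemma plmx_plucker x y i j :
  plmx (plucker x y) i j = x 0 i * y 0 j - x 0 j * y 0 i.
Proof. by elim/ord4_ind: i; elim/ord4_ind: j; rewrite !mxE /=; ring. Qed.

Lemma plmxZ c z : plmx (c *: z) = c *: plmx z.
Proof.
by apply/matrixP => i j; elim/ord4_ind: i; elim/ord4_ind: j; rewrite !mxE /=; ring.
Qed.

Lemma plmx_eq0 z : (forall i j, plmx z i j = 0) -> z = 0.
Proof.
move=> z0; apply/rowP => k; rewrite [RHS]mxE; elim/ord6_ind: k.
- by have := z0 0 1; rewrite mxE.
- by have := z0 0 2; rewrite mxE.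
- by have := z0 0 3; rewrite mxE.
- by have := z0 1 2; rewrite mxE.
- by have := z0 1 3; rewrite mxE.
- by have := z0 2 3; rewrite mxE.
Qed.

Lemma plmx_neq0 z : z != 0 -> exists i j, plmx z i j != 0.
Proof.
move=> z0; suff /existsP[i /existsP[j ?]] : [exists i, exists j, plmx z i j != 0].
  by exists i, j.
apply: contraNT z0 => /existsPn N; apply/eqP/plmx_eq0 => i j; apply/eqP.
by have /existsPn/(_ j)/negPn := N i.
Qed.

(** Inverts the Klein correspondence: any two rows meeting in a non-zero entry span a line whose
    Plücker vector is proportional to [z]. *)
Lemma plucker_plmx z i j : kleinQ z = 0 ->
  plucker (row i (plmx z)) (row j (plmx z)) = plmx z i j *: z.
Proof.
rewrite /kleinQ => Qz; apply/rowP => k.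
elim/ord6_ind: k; rewrite [LHS]mxE [RHS]mxE /= ![row _ _ _ _]mxE.
all: elim/ord4_ind: i; elim/ord4_ind: j.
all: rewrite ![plmx _ _ _]mxE /=.
all: move: (z 0 0) (z 0 1) (z 0 2) (z 0 3) (z 0 4) (z 0 5) Qz => a b c d e f Qz.
all: try ring.
(* Left are the coordinates complementary to [i] and [j], where the two sides differ by plus or
   minus the Plücker form. *)
all: apply: subr0_eq; first [rewrite -Qz; ring | rewrite -oppr0 -Qz; ring].
Qed.

Lemma row_plmx_plucker x y i :
  row i (plmx (plucker x y)) = x 0 i *: y - y 0 i *: x.
Proof. by apply/rowP => j; rewrite [LHS]mxE plmx_plucker !mxE; ring. Qed.

Lemma kleinQ_plucker x y : kleinQ (plucker x y) = 0.
Proof. by rewrite /kleinQ !mxE /=; ring. Qed.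

Lemma plucker_comb x y a b c d :
  plucker (a *: x + b *: y) (c *: x + d *: y) = (a * d - b * c) *: plucker x y.
Proof. by apply/rowP; elim/ord6_ind; rewrite !mxE /=; ring. Qed.

Lemma plucker_is_linear x : linear (plucker x).
Proof. by move=> a u v; apply/rowP; elim/ord6_ind; rewrite !mxE /=; ring. Qed.

HB.instance Definition _ x :=
  GRing.isLinear.Build F 'rV[F]_4 'rV[F]_6 _ (plucker x) (plucker_is_linear x).

Lemma plucker_eq0 x y : x != 0 -> (plucker x y == 0) = (y \in <[x]>%VS).
Proof.
move=> x0; apply/eqP/vlineP => [xy0|[k ->]]; last first.
  have := plucker_comb x 0 1 0 k 0.
  by rewrite !(scaler0, addr0, scale1r) mulr0 mul0r subr0 scale0r.
have /rV0Pn[i xi0] := x0.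
exists (y 0 i / x 0 i); apply/rowP => j; rewrite !mxE.
have := plmx_plucker x y i j; rewrite xy0 -(scale0r 0) plmxZ !mxE mul0r.
move/esym/subr0_eq => xyE.
by apply: (mulfI xi0); rewrite xyE; field.
Qed.

(** Frees [klein] from the arbitrary basis in its definition: the change-of-basis determinant is
    non-zero because [plucker x y] is. *)
Lemma klein_join x y : x != 0 -> y \notin <[x]>%VS ->
  klein (<[x]> + <[y]>) = <[plucker x y]>%VS.
Proof.
move=> x0 yx; rewrite /klein; set l := (_ + _)%VS.
have dim_l : \dim l = 2 by exact: is_line_join.
have lE : l = (<[(vbasis l)`_0]> + <[(vbasis l)`_1]>)%VS.
  have sz : size (vbasis l) = 2 by rewrite size_tuple.
  move: (tval (vbasis l)) sz (span_basis (vbasisP l)) => [|u [|v [|//]]] // _ <-.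
  by rewrite span_cons span_seq1.
move: (vbasis l)`_0 (vbasis l)`_1 lE => u v lE.
have : x \in l by rewrite memvE addvSl.
have : y \in l by rewrite memvE addvSr.
rewrite lE => /memv_joinP[c [d yE]] /memv_joinP[a [b xE]].
have := plucker_eq0 y x0; rewrite (negPf yx) xE yE plucker_comb => /negbT.
by rewrite scaler_eq0 negb_or => /andP[e0 _]; rewrite vlineZ.
Qed.

(** The rows of the matrix of the first line are, by proportionality, combinations of [x2] and [y2];
    two of them recover [x1] and [y1]. *)
Lemma plucker_subv x1 y1 x2 y2 c : plucker x1 y1 != 0 ->
  plucker x1 y1 = c *: plucker x2 y2 -> (<[x1]> + <[y1]> <= <[x2]> + <[y2]>)%VS.
Proof.
move=> xy0 xyE; have [i [j pij0]] := plmx_neq0 xy0.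
have row_l2 k : row k (plmx (plucker x1 y1)) \in (<[x2]> + <[y2]>)%VS.
  rewrite xyE plmxZ linearZ /= row_plmx_plucker; apply/memvZ/memv_joinP.
  by exists (- y2 0 k), (x2 0 k); rewrite addrC scaleNr.
pose M := plmx (plucker x1 y1).
(* Both [w = x1] and [w = y1] satisfy this identity, and [M i j] can be divided out. *)
have in_l2 (w : 'rV[F]_4) : M i j *: w = w 0 j *: row i M - w 0 i *: row j M ->
    w \in (<[x2]> + <[y2]>)%VS.
  move=> wE; have : M i j *: w \in (<[x2]> + <[y2]>)%VS.
    by rewrite wE memvB // memvZ.
  by rewrite rpredZeq (negPf pij0).
rewrite subv_add -!memvE; apply/andP; split; apply: in_l2.
  by rewrite plmx_plucker !row_plmx_plucker; apply/rowP => k; rewrite !mxE; ring.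
by rewrite plmx_plucker !row_plmx_plucker; apply/rowP => k; rewrite !mxE; ring.
Qed.

Lemma line_basis l : is_line l ->
  exists x y, [/\ x != 0, y \notin <[x]>%VS & l = (<[x]> + <[y]>)%VS].
Proof.
move=> ll; have x0 : vpick l != 0 by rewrite vpick0 -dimv_eq0 ll.
by have [y yx lE] := line_joinP ll x0 (memv_pick l); exists (vpick l), y.
Qed.

Lemma klein_inj l1 l2 : is_line l1 -> is_line l2 -> klein l1 = klein l2 -> l1 = l2.
Proof.
move=> ll1 ll2; have [x1 [y1 [x10 yx1 l1E]]] := line_basis ll1.
have [x2 [y2 [x20 yx2 l2E]]] := line_basis ll2.
rewrite {1}l1E {1}l2E !klein_join // => kE.
apply/eqP; rewrite eqEdim ll1 ll2 leqnn andbT l1E l2E.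
have /vlineP[c pE] : plucker x1 y1 \in <[plucker x2 y2]>%VS by rewrite -kE memv_line.
by apply: plucker_subv pE; rewrite plucker_eq0.
Qed.

Lemma klein_surj R : klein_point R ->
  exists x y, [/\ x != 0, y \notin <[x]>%VS & R = <[plucker x y]>%VS].
Proof.
case=> /is_pointP[z z0 ->] /(_ z (memv_line z)) Qz.
have [i [j zij0]] := plmx_neq0 z0.
have pE := plucker_plmx i j Qz.
have p0 : plucker (row i (plmx z)) (row j (plmx z)) != 0.
  by rewrite pE scaler_eq0 negb_or zij0.
have x0 : row i (plmx z) != 0.
  by apply: contraNneq zij0 => /rowP/(_ j)/eqP; rewrite mxE [X in _ == X]mxE.
exists (row i (plmx z)), (row j (plmx z)); split=> //; first by rewrite -plucker_eq0.
by rewrite pE vlineZ.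
Qed.

(** * Latin planes, their vertices, and their distinctness from Greek planes *)

Definition latin_img x : {vspace 'rV[F]_6} := limg (linfun (plucker x)).

(** The kernel of [plucker x] is the point spanned by [x], so the image has dimension 4 - 1 = 3. *)
Lemma latin_img_plane x : x != 0 -> klein_plane (latin_img x).
Proof.
move=> x0; split=> [|_ /memv_imgP[y _ ->]]; last by rewrite lfunE kleinQ_plucker.
have kerE : lker (linfun (plucker x)) = <[x]>%VS.
  apply/eqP; rewrite eqEsubv; apply/andP; split; apply/subvP => y;
  by rewrite memv_ker lfunE /= plucker_eq0.
have := limg_ker_dim (linfun (plucker x)) fullv.
by rewrite capfv kerE dim_vline x0 dimvf dim_matrix => -[].
Qed.

Lemma latin_plane_img x : x != 0 -> latin_plane <[x]>%VS (latin_img x).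
Proof.
move=> x0; apply/seteqP; split=> [R [/is_pointP[z z0 ->]]|_ [l [ll xl] <-]].
  rewrite -memvE => /memv_imgP[y _]; rewrite lfunE /= => zE.
  have yx : y \notin <[x]>%VS by rewrite -plucker_eq0 // -zE.
  exists (<[x]> + <[y]>)%VS; last by rewrite klein_join // zE.
  by split; [exact: is_line_join|exact: addvSl].
rewrite -memvE in xl; have [y yx ->] := line_joinP ll x0 xl.
rewrite klein_join //; split.
  by apply/is_pointP; exists (plucker x y); rewrite ?plucker_eq0.
by rewrite -memvE; apply/memv_imgP; exists y; rewrite ?memvf ?lfunE.
Qed.

(** Injectivity of [klein] turns an equality of images into an inclusion of sets of lines. [L] will
    be the lines through another point or the lines in a plane. *)
Lemma latin_plane_sub P (L : set {vspace 'rV[F]_4}) pi : L `<=` @is_line _ _ ->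
  latin_plane P pi -> points_of pi = @klein F @` L -> lines_through P `<=` L.
Proof.
move=> Lline PE LE l lP.
have : (@klein F @` L) (klein l) by rewrite -LE PE; exists l.
case=> l' Ll' /klein_inj <- //; [exact: Lline|by case: lP].
Qed.

(** Every line through [x] would pass through [x']; if the points differ, joining [x] to a vector
    [y] off their common line gives a contradiction. *)
Lemma latin_plane_inj x x' pi : x != 0 -> x' != 0 ->
  latin_plane <[x]>%VS pi -> latin_plane <[x']>%VS pi -> <[x]>%VS = <[x']>%VS.
Proof.
move=> x0 x'0 Lx Lx'.
have sub : lines_through <[x]>%VS `<=` lines_through <[x']>%VS.
  by apply: latin_plane_sub Lx Lx' => l [].
have [x'x|x'x] := boolP (x' \in <[x]>%VS).
  by apply/esym/eqP; rewrite eqEdim -memvE x'x !dim_vline x0 x'0.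
have [|y yxx'] := @exists_notin _ _ (<[x]> + <[x']>)%VS.
  by rewrite is_line_join // dim_matrix.
have yx : y \notin <[x]>%VS.
  by apply: contraNN yxx'; apply: subvP; exact: addvSl.
have [] := sub (<[x]> + <[y]>)%VS.
  by split; [exact: is_line_join|exact: addvSl].
move=> _ x'l; case/negP: yxx'.
suff -> : (<[x]> + <[x']> = <[x]> + <[y]>)%VS by rewrite memvE addvSr.
by apply/eqP; rewrite eqEdim subv_add addvSl x'l !is_line_join.
Qed.

(** The polar form is non-degenerate: pairing [x] with a basis vector reads off the coordinate that
    is its partner in X0X1 + X2X3. *)
Lemma hyp_perp_neq_full x : x != 0 -> hyp_perp <[x]>%VS <> fullv.
Proof.
move=> x0 pE; case/eqP: x0.
have B0 y : hypB y x = 0.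
  have : y \in hyp_perp <[x]>%VS by rewrite pE memvf.
  by rewrite mem_orthov1 => /eqP.
apply/rowP => i; rewrite [RHS]mxE.
elim/ord4_ind: i.
- by rewrite -(B0 (delta_mx 0 1)) /hypB /hypQ !mxE /=; ring.
- by rewrite -(B0 (delta_mx 0 0)) /hypB /hypQ !mxE /=; ring.
- by rewrite -(B0 (delta_mx 0 3)) /hypB /hypQ !mxE /=; ring.
- by rewrite -(B0 (delta_mx 0 2)) /hypB /hypQ !mxE /=; ring.
Qed.

(** Otherwise all lines through [x] lie in the plane perpendicular to [x']; as they cover the space,
    that plane would be everything. *)
Lemma latin_plane_not_greek x x' pi : x != 0 -> x' != 0 ->
  latin_plane <[x]>%VS pi -> ~ greek_plane <[x']>%VS pi.
Proof.
move=> x0 x'0 Lx Gx'; apply: (hyp_perp_neq_full x'0).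
have sub : lines_through <[x]>%VS `<=` lines_in (hyp_perp <[x']>%VS).
  by apply: latin_plane_sub Lx Gx' => l [].
have subU y : y \notin <[x]>%VS -> (<[x]> + <[y]> <= hyp_perp <[x']>)%VS.
  by move=> yx; case: (sub (<[x]> + <[y]>)%VS) => //;
    split; [exact: is_line_join|exact: addvSl].
apply/eqP; rewrite eqEsubv subvf /=; apply/subvP => y _.
have [yx|/subU] := boolP (y \in <[x]>%VS); last first.
  by rewrite subv_add -!memvE => /andP[].
(* A multiple of [x] lies on the join of [x] with any vector [w] outside its span. *)
have [|w /subU] := @exists_notin _ _ <[x]>%VS.
  by rewrite dim_vline x0 dim_matrix.
by rewrite subv_add => /andP[/subvP xU _]; exact: xU.
Qed.

(** * Pencils inside a union of Latin and Greek families *)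

Lemma no_point_pencil (A B : set {vspace 'rV[F]_4}) :
  A `<=` @is_point _ _ -> B `<=` @is_point _ _ ->
  (forall l, is_line l -> exists x, [/\ x != 0, x \in l & ~ A <[x]>%VS]) ->
  ~ contains_point_pencil
      ([set pi | exists2 P, A P & latin_plane P pi] `|`
       [set pi | exists2 P, B P & greek_plane P pi]).
Proof.
(* The vertex of the pencil is the image of a line; the Latin plane of a point of that line outside
   [A] lies in the pencil but in neither family. *)
move=> Apt Bpt lineNA [R /klein_surj[u [v [u0 vu ->]]] sub].
have lineE := is_line_join u0 vu.
have [x [x0 xl NAx]] := lineNA _ lineE.
have [y yx lE] := line_joinP lineE x0 xl.
have RE : <[plucker u v]>%VS = <[plucker x y]>%VS.
  by rewrite -!klein_join // lE.
have Lx := latin_plane_img x0.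
case: (sub (latin_img x)).
- split; first exact: latin_img_plane.
  rewrite RE -memvE; apply/memv_imgP.
  by exists y; rewrite ?memvf ?lfunE.
- case=> P AP; have /is_pointP[x' x'0 PE] := Apt _ AP; rewrite PE => Lx'.
  by apply: NAx; rewrite (latin_plane_inj x0 x'0 Lx Lx') -PE.
- case=> P BP; have /is_pointP[x' x'0 ->] := Bpt _ BP.
  exact: latin_plane_not_greek Lx.
Qed.

(** A member of [S] supplies a vertex in [V], whose whole pencil then lies in [S]; non-emptiness
    excludes the union over no vertices. *)
Lemma not_union_of_pencils (S : set {vspace 'rV[F]_6}) :
  S !=set0 -> ~ contains_point_pencil S -> ~ union_of_noncollinear_pencils S.
Proof.
move=> [pi Spi] NS [V [Vpt _ SE]]; move: Spi; rewrite {1}SE => -[R VR _].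
by apply: NS; exists R; [exact: Vpt|rewrite SE => pi' piR; exists R].
Qed.

End Klein.

(** * Squares in a finite field of odd order, and the values of the quadratic form on a line *)

Section Squares.
Variables (F : finFieldType) (odd_F : odd #|F|).

Let sq (a : F) := a ^+ 2.

(** In characteristic 2 the order is a power of 2, which is odd only when it is 1. *)
Lemma two_neq0 : 2%:R != 0 :> F.
Proof.
apply/negP => two0; have pcharF2 : 2 \in [pchar F] by rewrite inE /=.
have := card_pprimeChar pcharF2; rewrite -[#|pPrimeCharType _|]/#|F| => cardF.
have := finNzRing_gt1 F; move: odd_F; rewrite cardF oddX orbF => /eqP ->.
by rewrite expn0.
Qed.

(* [x] is determined by its square and by whether it is the chosen root. *)
Lemma card_squares : (#|F| < 2 * #|sq @: F|)%N.
Proof.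
pose S := sq @: F.
suff : (#|F| <= #|S| * 2)%N.
  (* The bound is strict because equality would make the order even. *)
  rewrite mulnC leq_eqVlt => /predU1P[cardF|//].
  by move: odd_F; rewrite cardF mul2n odd_double.
pose r a := odflt 0 [pick b : F | sq b == a].
pose h x := (sq x, x == r (sq x)).
have rK x : sq (r (sq x)) = sq x.
  by rewrite /r; case: pickP => [b /eqP //|/(_ x)]; rewrite eqxx.
have h_inj : injective h.
  move=> x y [xy]; have := rK x; rewrite -xy; set b := r _ => bx.
  have : (x == b) || (x == - b) by rewrite -eqf_sqr -/(sq x) -/(sq b) bx.
  have : (y == b) || (y == - b) by rewrite -eqf_sqr -/(sq y) -/(sq b) bx xy.
  case: (x =P b) => [->|_]; case: (y =P b) => [->|_] //=.
  by move=> /eqP-> /eqP->.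
rewrite -(card_imset F h_inj) -card_bool -cardsT -cardsX.
apply/subset_leq_card/fintype.subsetP => _ /imsetP[x _ ->].
by rewrite !inE /= andbT; apply/imsetP; exists x.
Qed.

(** Otherwise squaring is surjective, hence injective by finiteness, although 1 and -1 have the same
    square. *)
Lemma exists_nonsquare : exists e : F, forall a, e != a ^+ 2.
Proof.
suff /existsP[e /forallP] : [exists e : F, [forall a, e != a ^+ 2]] by exists e.
apply/existsPn => Nex.
have surj e : exists a, sq a == e.
  by have /forallPn[a /negPn/eqP ->] := Nex e; exists a; rewrite /sq.
pose g e := xchoose (surj e).
have gK : cancel g sq by move=> e; apply/eqP/(xchooseP (surj e)).
have /bij_inj sq_inj : bijective sq.
  have [g' gg' g'g] := injF_bij (can_inj gK).
  by exists g => // x; rewrite -[x]g'g gK.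
have /eqP : 1 = -1 :> F by apply: sq_inj; rewrite /sq sqrrN.
by rewrite -subr_eq0 opprK -mulr2n (negPf two_neq0).
Qed.

(* Pigeonhole: more than half of the elements have the form [x ^+ 2], and more
   than half have the form [e - d * y ^+ 2]. *)
Lemma binary_form_surj (d e : F) : d != 0 -> exists x y, e = x ^+ 2 + d * y ^+ 2.
Proof.
move=> d0; pose S := sq @: F; pose f a := e - d * a.
have f_inj : injective f by move=> a b /addrI/oppr_inj/(mulfI d0).
have : ~~ [disjoint S & f @: S].
  apply/negP => /disjoint_setI0 SfS0.
  have := card_squares; rewrite ltnNge => /negP; apply.
  rewrite mul2n -addnn -{2}(card_imset S f_inj) -cardsUI SfS0 cards0 addn0.
  exact: max_card.
case/pred0Pn => a /andP[/imsetP[x _ aE] /imsetP[_ /imsetP[y _ ->]]].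
by rewrite aE /f /sq => xE; exists x, y; rewrite xE subrK.
Qed.

Lemma hypQ_comb (x y : 'rV[F]_4) s t :
  hypQ (s *: x + t *: y) = s ^+ 2 * hypQ x + s * t * hypB x y + t ^+ 2 * hypQ y.
Proof. by rewrite /hypB /hypQ !mxE; ring. Qed.

(** A singular point is neither square nor non-square, so with [e] of the opposite class either
    outcome gives a point outside a prescribed class. *)
Lemma line_represents l (e : F) : is_line l -> e != 0 ->
  exists x, [/\ x != 0, x \in l & hypQ x = 0 \/ hypQ x = e].
Proof.
move=> ll e0; have [u [v [u0 vu ->]]] := line_basis ll.
set a := hypQ u; set b := hypB u v; set c := hypQ v.
have [a0|a0] := eqVneq a 0.
  by exists u; split=> //; [rewrite memvE addvSl|left].
(* The Gram determinant of the form restricted to the line. *)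
pose d := a * c - (b / 2%:R) ^+ 2.
have two0 := two_neq0.
(* Completing the square in [a * hypQ (s *: u + t *: v)]. *)
have formE s t :
    a * hypQ (s *: u + t *: v) = (a * s + b / 2%:R * t) ^+ 2 + d * t ^+ 2.
  by rewrite hypQ_comb -/a -/b -/c /d; field.
have in_l s t : s *: u + t *: v \in (<[u]> + <[v]>)%VS.
  by apply/memv_joinP; exists s, t.
have [d0|d0] := eqVneq d 0.
  (* With [d = 0] only the square [(a * s + b / 2 * t) ^+ 2] remains; it vanishes here, with
     [t = 1]. *)
  exists (- (b / 2%:R / a) *: u + 1 *: v); split=> //.
    apply: contraNneq vu => /eqP; rewrite scaleNr addrC subr_eq0 scale1r => /eqP->.
    by rewrite memvZ ?memv_line.
  left; apply: (mulfI a0); rewrite formE d0 mulr0; field; exact/andP.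
(* The target is [a * e] since [formE] computes [a] times the form; the witness solves
   [a * s + b / 2 * t = X] with [t = Y]. *)
have [X [Y XY]] := binary_form_surj (a * e) d0.
exists (((X - b / 2%:R * Y) / a) *: u + Y *: v).
have QE : hypQ (((X - b / 2%:R * Y) / a) *: u + Y *: v) = e.
  by apply: (mulfI a0); rewrite formE XY; field; exact/andP.
split=> //; last by right.
apply: contraNneq e0 => w0; rewrite -QE w0.
by rewrite /hypQ !mxE mul0r addr0.
Qed.

(** * Square and non-square points: independence of the representative, and existence *)

Lemma square_pointE (x : 'rV[F]_4) : square_point <[x]>%VS ->
  exists2 a, a != 0 & hypQ x = a ^+ 2.
Proof.
case=> y [y0 xyE [a a0 Qy]].
have /vlineP[c xE] : x \in <[y]>%VS by rewrite -xyE memv_line.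
have c0 : c != 0.
  apply: contraNneq y0 => c0; have : y \in <[x]>%VS by rewrite xyE memv_line.
  by rewrite xE c0 scale0r => /vlineP[k ->]; rewrite scaler0.
exists (c * a); rewrite ?mulf_neq0 // exprMn -Qy xE.
by rewrite /hypQ !mxE; ring.
Qed.

Lemma non_square_pointE (x : 'rV[F]_4) : non_square_point <[x]>%VS ->
  ~ exists a, hypQ x = a ^+ 2.
Proof.
case=> y [y0 xyE NQy] [a Qx]; apply: NQy.
have /vlineP[c yE] : y \in <[x]>%VS by rewrite xyE memv_line.
by exists (c * a); rewrite exprMn -Qx yE /hypQ !mxE; ring.
Qed.

(** For a non-square [e], neither of the values 0 and [e] is a non-zero square. *)
Lemma line_not_square (l : {vspace 'rV[F]_4}) : is_line l ->
  exists x, [/\ x != 0, x \in l & ~ square_point <[x]>%VS].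
Proof.
move=> ll; have [e Ne] := exists_nonsquare.
have e0 : e != 0 by have := Ne 0; rewrite expr0n.
have [x [x0 xl Qx]] := line_represents ll e0.
exists x; split=> // /square_pointE[a a0]; case: Qx => -> /eqP.
  by rewrite eq_sym expf_eq0 (negPf a0).
by rewrite (negPf (Ne a)).
Qed.

(** With [e = 1], both possible values 0 and 1 are squares. *)
Lemma line_not_non_square (l : {vspace 'rV[F]_4}) : is_line l ->
  exists x, [/\ x != 0, x \in l & ~ non_square_point <[x]>%VS].
Proof.
move=> ll; have [x [x0 xl Qx]] := line_represents ll (oner_neq0 F).
exists x; split=> // /non_square_pointE; apply.
by case: Qx => ->; [exists 0; rewrite expr0n|exists 1; rewrite expr1n].
Qed.

Lemma square_point_is_point : @square_point F `<=` @is_point _ _.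
Proof. by move=> _ [x [x0 -> _]]; apply/is_pointP; exists x. Qed.

Lemma non_square_point_is_point : @non_square_point F `<=` @is_point _ _.
Proof. by move=> _ [x [x0 -> _]]; apply/is_pointP; exists x. Qed.

(** The vector (1, e, 0, 0) has value [e]; this provides vertices showing that the Latin families
    are non-empty. *)
Lemma hypQ_surj (e : F) : exists2 x : 'rV[F]_4, x != 0 & hypQ x = e.
Proof.
exists (delta_mx 0 0 + e *: delta_mx 0 1).
  by apply/eqP => /rowP/(_ 0)/eqP; rewrite !mxE /= mulr0 addr0 oner_eq0.
by rewrite /hypQ !mxE /=; ring.
Qed.

Lemma S_l_neq0 : S_l F !=set0.
Proof.
have [x x0 Qx] := hypQ_surj 1.
exists (latin_img x); exists <[x]>%VS; last exact: latin_plane_img.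
by exists x; split=> //; exists 1; rewrite ?oner_neq0 // expr1n.
Qed.

Lemma NS_l_neq0 : NS_l F !=set0.
Proof.
have [e Ne] := exists_nonsquare; have [x x0 Qx] := hypQ_surj e.
exists (latin_img x); exists <[x]>%VS; last exact: latin_plane_img.
by exists x; split=> // -[a /eqP]; rewrite Qx (negPf (Ne a)).
Qed.

End Squares.

(* The four unions of plane families *)
Local Close Scope ring_scope.

Theorem proposition3p9 (F : finFieldType) (q : nat)
    (card_F : #|F| = q) (odd_q : odd q) :
  (q = 1 %[mod 4] ->
     [/\ ~ contains_point_pencil (S_l F `|` S_g F),
         ~ contains_point_pencil (NS_l F `|` NS_g F),
         ~ union_of_noncollinear_pencils (S_l F `|` S_g F)
       & ~ union_of_noncollinear_pencils (NS_l F `|` NS_g F)]) /\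
  (q = 3 %[mod 4] ->
     [/\ ~ contains_point_pencil (S_l F `|` NS_g F),
         ~ contains_point_pencil (S_g F `|` NS_l F),
         ~ union_of_noncollinear_pencils (S_l F `|` NS_g F)
       & ~ union_of_noncollinear_pencils (S_g F `|` NS_l F)]).
Proof.
have odd_F : odd #|F| by rewrite card_F.
have [pi Spi] := S_l_neq0 F; have [pi' NSpi'] := NS_l_neq0 odd_F.
pose sqP := @square_point_is_point F; pose nsqP := @non_square_point_is_point F.
(* [B] stays general, since each Latin family is paired with both Greek families across the two
   congruence classes. *)
have no_S B (Bpt : B `<=` @is_point _ _) :=
  no_point_pencil sqP Bpt (@line_not_square F odd_F).
have no_NS B (Bpt : B `<=` @is_point _ _) :=
  no_point_pencil nsqP Bpt (@line_not_non_square F odd_F).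
(* Commuting the union puts the Latin family first, as in [no_point_pencil]. *)
split=> _; rewrite ?[S_g F `|` _]setUC; split.
- exact: no_S sqP.
- exact: no_NS nsqP.
- by apply: not_union_of_pencils (no_S _ sqP); exists pi; left.
- by apply: not_union_of_pencils (no_NS _ nsqP); exists pi'; left.
- exact: no_S nsqP.
- exact: no_NS sqP.
- by apply: not_union_of_pencils (no_S _ nsqP); exists pi; left.
- by apply: not_union_of_pencils (no_NS _ sqP); exists pi'; left.
Qed.
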